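(* Let $X$ be a normed real vector space and let $\theta=(k_r)$ be a lacunary sequence. Then $X$ is complete if and only if $S_{S_\theta}(\sum_i x_i)$ is a complete space (with the supremum norm) for every weakly unconditionally Cauchy series (wuC) $\sum_i x_i$ in $X$.
   Context: A lacunary sequence is a (strictly) increasing sequence $\theta=(k_r)_{r\ge 0}$ of natural numbers with $k_0=0$ and $h_r=k_r-k_{r-1}\to+\infty$ as $r\to\infty$. For $r\ge 1$ put $I_r=(k_{r-1},k_r]$ (the set of integers $k$ with $k_{r-1}<k\le k_r$). A sequence $(s_k)$ in the normed space $X$ is $S_\theta$-convergent (lacunary statistically convergent) to $L\in X$ if for every $\varepsilon>0$, $\lim_{r\to\infty}\frac{1}{h_r}\mathrm{card}(\{k\in I_r:\|s_k-L\|\ge\varepsilon\})=0$. A series $\sum_i z_i$ in $X$ is $S_\theta$-summable if its sequence of partial sums $s_k=\sum_{i=1}^k z_i$ is $S_\theta$-convergent to some $L\in X$. $\ell_\infty$ is the space of bounded real sequences. For a series $\sum_i x_i$ in $X$, $$S_{S_\theta}\Big(\sum_i x_i\Big)=\Big\{(a_i)_i\in\ell_\infty:\ \sum_i a_i x_i \text{ is } S_\theta\text{-summable}\Big\},$$ endowed with the supremum norm. A series $\sum_i x_i$ in $X$ is weakly unconditionally Cauchy (wuC) if for every permutation $\pi$ of $\mathbb{N}$ the sequence $(\sum_{i=1}^n x_{\pi(i)})_n$ is weakly Cauchy; equivalently, $\sum_i|f(x_i)|<\infty$ for every $f\in X^*$. *)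

(* Defs.v *)
From HB Require Import structures.
From mathcomp Require Import all_boot all_order all_algebra.
From mathcomp Require Import all_classical all_reals all_analysis.

Set Implicit Arguments.
Unset Strict Implicit.
Unset Printing Implicit Defensive.

Import Order.TTheory GRing.Theory Num.Theory.
Import numFieldNormedType.Exports.

Local Open Scope classical_set_scope.
Local Open Scope ring_scope.

(* A series sum_(i >= 1) z_i is encoded by z : nat -> X with z i standing for
   z_(i+1); the library's [series z n] = \sum_(0 <= i < n) z i is then the sum
   of the first n terms, i.e. the partial sum s_n. *)

(* h_r and I_r are used for r >= 1; at r = 0 they degenerate to 0 and the empty
   interval, which does not affect limits in r. *)
Definition lacunary_gap (k : nat -> nat) (r : nat) : nat := (k r - k r.-1)%N.

(* index_iota m n enumerates m <= j < n, so this is (k_(r-1), k_r] *)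
Definition lacunary_block (k : nat -> nat) (r : nat) : seq nat :=
  index_iota (k r.-1).+1 (k r).+1.

Definition lacunary (k : nat -> nat) : Prop :=
  [/\ k 0%N = 0%N,
      forall m n : nat, (m < n)%N -> (k m < k n)%N &
      lacunary_gap k @ \oo --> \oo].

Definition S_theta_cvg (R : realType) (X : normedModType R) (k : nat -> nat)
    (s : nat -> X) (L : X) : Prop :=
  forall e : R, 0 < e ->
    (fun r : nat =>
       (lacunary_gap k r)%:R^-1 *
       (count (fun j => e <= `|s j - L|) (lacunary_block k r))%:R : R)
      @ \oo --> (0 : R).

Definition S_theta_summable (R : realType) (X : normedModType R)
    (k : nat -> nat) (z : nat -> X) : Prop :=
  exists L : X, S_theta_cvg k (series z) L.

Definition ell_infty (R : realType) : set (nat -> R) :=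
  [set a | [bounded a i | i in [set: nat]]].

(* [sup] is junk on unbounded sets: only meaningful on ell_infty *)
Definition sup_norm (R : realType) (a : nat -> R) : R :=
  sup [set `|a i| | i in [set: nat]].

Definition S_theta_space (R : realType) (X : normedModType R)
    (k : nat -> nat) (x : nat -> X) : set (nat -> R) :=
  [set a | ell_infty a /\ S_theta_summable k (fun i => a i *: x i)].

(* intended for A contained in ell_infty *)
Definition sup_norm_complete (R : realType) (A : set (nat -> R)) : Prop :=
  forall u : nat -> nat -> R,
    (forall n, A (u n)) ->
    (forall e : R, 0 < e -> exists N : nat, forall m n : nat,
        (N <= m)%N -> (N <= n)%N -> sup_norm (fun i => u m i - u n i) < e) ->
    exists2 a : nat -> R, A a &
      (fun n => sup_norm (fun i => u n i - a i)) @ \oo --> (0 : R).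

Definition weakly_cauchy (R : realType) (X : normedModType R)
    (s : nat -> X) : Prop :=
  forall f : {linear X -> R^o}, continuous f -> cauchy ((f \o s) @ \oo).

Definition weakly_uncond_cauchy (R : realType) (X : normedModType R)
    (x : nat -> X) : Prop :=
  forall p : nat -> nat, bijective p -> weakly_cauchy (series (x \o p)).

(* the content of [Uniform_isComplete] as a proposition, so that completeness
   can be a hypothesis or a conclusion about a given normed space *)
Definition complete_space (R : realType) (X : normedModType R) : Prop :=
  forall F : set_system X, ProperFilter F -> cauchy F -> cvg F.

(* Main.v *)
(* If X is complete and sum x_i is wuC, then for each functional f the series
   sum |f (x_i)| converges; by Hahn-Banach and uniform boundedness there is H
   with |sum_(i < n) a_i x_i| <= H |a|_oo for all n and a.  Hence, when bounded
   multipliers u_n converge uniformly to a, the partial sums converge uniformly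
   in the length, so the S_theta-limits L_n are Cauchy and their limit is the
   S_theta-limit of sum a_i x_i.
   Conversely, a Cauchy filter of X yields points y_i with |y_(i+1) - y_i| of
   order 4^-i.  The terms x_i = 2^i (y_(i+1) - y_i) have summable norms, so
   sum x_i is wuC, and the truncations of a = (2^-i) are multipliers converging
   uniformly to a.  So sum a_i x_i, whose partial sums are y_n - y_0, has an
   S_theta-limit L, and the filter converges to y_0 + L. *)
Require Import Defs.
From HB Require Import structures.
From mathcomp Require Import all_boot all_order all_algebra.
From mathcomp Require Import all_classical all_reals all_analysis.
From mathcomp Require Import ring lra zify.
Import Order.TTheory GRing.Theory Num.Theory.
Import numFieldNormedType.Exports.

Set Implicit Arguments.
Unset Strict Implicit.
Unset Printing Implicit Defensive.

Local Open Scope classical_set_scope.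
Local Open Scope ring_scope.

(** * Rearrangements of real series *)

Lemma cauchy_seqP (R : realType) (X : normedModType R) (u : nat -> X) :
  cauchy (u @ \oo) <->
  forall e : R, 0 < e -> exists N, forall m n, (N <= m)%N -> (N <= n)%N ->
    `|u m - u n| < e.
Proof.
split=> [/cauchyP uC e e0|uC].
  have [x [N _ xN]] := uC _ (divr_gt0 e0 (ltr0n R 2)).
  exists N => m n Nm Nn.
  have := xN m Nm; have := xN n Nn; rewrite -ball_normE /= => xn xm.
  rewrite (le_lt_trans (ler_distD x _ _))// [ltRHS](splitr e) ltrD//.
  by rewrite distrC.
apply/cauchyP => e e0; have [N uN] := uC e e0.
by exists (u N), N => // n Nn; rewrite -ball_normE /=; exact: uN.
Qed.

(** The concatenations [W j] of the first [j] blocks are nested prefixes permuting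
    [0, ..., N j - 1]. Reading [p] off any long enough prefix gives an injection, since [W j] has no
    repetition, and a surjection, since [v] occurs in [W v.+1]. *)
Lemma block_permutation (N : nat -> nat) (s : nat -> seq nat) :
  N 0%N = 0%N -> (forall j, (N j < N j.+1)%N) ->
  (forall j, perm_eq (s j) (index_iota (N j) (N j.+1))) ->
  exists2 p : nat -> nat, bijective p &
    forall j i, (i < size (s j))%N -> p (N j + i)%N = nth 0%N (s j) i.
Proof.
move=> N0 Nlt sP.
pose W := fix W j := if j is j'.+1 then W j' ++ s j' else [::].
have WP j : perm_eq (W j) (iota 0 (N j)).
  elim: j => [|j IH] /=; first by rewrite N0.
  have -> : N j.+1 = (N j + (N j.+1 - N j))%N by rewrite subnKC// ltnW.
  by rewrite iotaD add0n perm_cat.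
have szW j : size (W j) = N j by rewrite (perm_size (WP j)) size_iota.
have jN j : (j <= N j)%N.
  by elim: j => // j IH; exact: leq_ltn_trans IH (Nlt j).
have Wle j d i : (i < N j)%N -> nth 0%N (W (j + d)%N) i = nth 0%N (W j) i.
  move=> iN; elim: d => [|d <-]; first by rewrite addn0.
  rewrite addnS /= nth_cat szW ifT// (leq_trans iN)//.
  elim: d => [|d IH]; first by rewrite addn0.
  by rewrite addnS (leq_trans IH)// ltnW.
have Wnth j j' i : (i < N j)%N -> (i < N j')%N ->
    nth 0%N (W j) i = nth 0%N (W j') i.
  by move=> ij ij'; rewrite -(Wle _ j' _ ij) addnC Wle.
pose p i := nth 0%N (W i.+1) i.
have pE j i : (i < N j)%N -> p i = nth 0%N (W j) i.
  by move=> ij; apply: Wnth.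
exists p; last first.
  move=> j i ij; rewrite (pE j.+1) /=.
    by rewrite nth_cat szW ltnNge leq_addr/= addKn.
  rewrite -(subnKC (ltnW (Nlt j))) ltn_add2l.
  by rewrite (perm_size (sP j)) size_iota in ij.
have injp : injective p.
  move=> i i' /eqP; pose j := maxn i.+1 i'.+1.
  have ij : (i < N j)%N by rewrite (leq_trans _ (jN _))// leq_maxl.
  have ij' : (i' < N j)%N by rewrite (leq_trans _ (jN _))// leq_maxr.
  rewrite (pE j)// (pE j i')// nth_uniq ?szW//; first by move/eqP.
  by rewrite (perm_uniq (WP j)) iota_uniq.
have surp v : exists i, p i == v.
  have vW : v \in W v.+1 by rewrite (perm_mem (WP _)) mem_iota /= add0n.
  exists (index v (W v.+1)); rewrite (pE v.+1) ?nth_index//.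
  by rewrite -szW index_mem.
exists (fun v => xchoose (surp v)) => i; last exact/eqP/(xchooseP (surp i)).
by apply: injp; exact/eqP/(xchooseP (surp (p i))).
Qed.

(* Moving, inside suitable blocks, the terms [g i >= 0] to the front makes
   the partial sums oscillate by at least 1 on each block. *)
Lemma unconditional_cauchy_absolutely_bounded (R : realType) (g : nat -> R) :
  (forall p : nat -> nat, bijective p -> cauchy (series (g \o p) @ \oo)) ->
  exists M, forall n, \sum_(0 <= i < n) `|g i| <= M.
Proof.
move=> gC; apply: contrapT => noM.
pose P i := 0 <= g i.
have [N0 gN0] : exists N0, forall n, (N0 <= n)%N ->
    `|series g N0 - series g n| < 1.
  have /cauchy_seqP/(_ _ ltr01)[N0 gN0] : cauchy (series g @ \oo).
    by have := gC id; apply; exists id.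
  by exists N0 => n Nn; apply: gN0.
(* If the nonnegative terms past [m] always had sums below 1, the identity |g| = 2 g^+ - g, with
   signed sums bounded by the Cauchy property, would bound the absolute sums. *)
have next m : exists n, (m < n)%N /\ 1 <= \sum_(m <= i < n | P i) g i.
  apply: contrapT => /forallNP noN; apply: noM.
  have lt1 n : (m < n)%N -> \sum_(m <= i < n | P i) g i < 1.
    by move=> mn; rewrite ltNge; apply/negP => ?; apply: (noN n).
  exists (\sum_(0 <= i < m) `|g i| + 2 + series g m + `|series g N0| + 1) => n.
  pose n' := (maxn n (maxn m N0)).+1.
  have nn' : (n <= n')%N by rewrite /n'; lia.
  have mn' : (m < n')%N by rewrite /n'; lia.
  have Nn' : (N0 <= n')%N by rewrite /n'; lia.
  have le_n' : \sum_(0 <= i < n) `|g i| <= \sum_(0 <= i < n') `|g i|.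
    by rewrite [leRHS](big_cat_nat (n := n))//= lerDl sumr_ge0.
  apply: (le_trans le_n').
  rewrite [in leLHS](big_cat_nat (n := m)) ?(ltnW mn')//=.
  have -> : \sum_(m <= i < n') `|g i| =
      2 * \sum_(m <= i < n' | P i) g i - (series g n' - series g m).
    rewrite sub_series_geq ?(ltnW mn')// (big_mkcond P) mulr_sumr -sumrB.
    apply: eq_bigr => i _; rewrite /P; case: ifPn => gi.
      by rewrite ger0_norm//; ring.
    by rewrite ltr0_norm ?ltNge//; ring.
  have := lt1 _ mn'; have := gN0 _ Nn'.
  rewrite ltr_norml => /andP[_ h1]; have := ler_norm (- series g N0).
  rewrite normrN; lra.
have [nu nuP] := choice next.
pose N j := iter j nu 0%N.
have Nlt j : (N j < N j.+1)%N by rewrite /N iterS; have [] := nuP (N j).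
pose B j := index_iota (N j) (N j.+1).
pose s j := [seq i <- B j | P i] ++ [seq i <- B j | ~~ P i].
have [||p bp pE] := @block_permutation N s _ Nlt; first by [].
  by move=> j; exact: (permEl (perm_filterC P (B j))).
have /cauchy_seqP/(_ _ ltr01)[J gJ] := gC p bp.
have jN j : (j <= N j)%N.
  by elim: j => // j IH; exact: leq_ltn_trans IH (Nlt j).
pose c := size ([seq i <- B J | P i]).
(* The rearranged partial sums at [N J] and [N J + c] differ by exactly the nonnegative terms of
   block [J], of total at least 1. *)
have := gJ (N J + c)%N (N J) (leq_trans (jN J) (leq_addr _ _)) (jN J).
rewrite sub_series_geq ?leq_addr// -{1}[N J]add0n big_addn addKn.
suff -> : \sum_(0 <= i < c) (g \o p) (i + N J)%N =
    \sum_(i <- [seq i <- B J | P i]) g i.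
  by rewrite big_filter ltNge (le_trans (nuP (N J)).2)// ler_norm.
rewrite [RHS](big_nth 0%N) -/c; apply: eq_big_nat => i /andP[_ ic] /=.
by rewrite addnC pE /s ?nth_cat ?ic// size_cat ltn_addr.
Qed.

(** * Norming functionals and uniform boundedness *)

Section norming_functional.
Variables (R : realType) (X : normedModType R).

(** Partial functionals are kept as graphs, so that chains have their unions as upper bounds.
    Domination makes them single-valued: if [(v, r)] and [(v, s)] lie in [G], so does [(0, s - r)],
    whence [s <= r], and symmetrically. *)
Definition dominated_graph (G : set (X * R)) :=
  (forall (a : R) p q, G p -> G q -> G (a *: p.1 + q.1, a * p.2 + q.2)) /\
  (forall p, G p -> p.2 <= `|p.1|).

(** The value [c] at [v] must lie between the numbers [p.2 - |p.1 - v|] and [|q.1 + v| - q.2]. The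
    triangle inequality separates the two families, and [c] is the supremum of the first. *)
Lemma dominated_graph_extend (G : set (X * R)) (v : X) :
  dominated_graph G -> G !=set0 ->
  exists c, dominated_graph
    [set q | exists2 p, G p & exists t, q = (p.1 + t *: v, p.2 + t * c)].
Proof.
move=> [Glin Gdom] [p0 Gp0].
pose S := [set p.2 - `|p.1 - v| | p in G].
have S0 : S !=set0 by exists (p0.2 - `|p0.1 - v|), p0.
have Sub q : G q -> ubound S (`|q.1 + v| - q.2).
  move=> Gq _ [p Gp <-].
  have := Gdom _ (Glin 1 _ _ Gp Gq); rewrite /= scale1r mul1r => h.
  have := ler_normD (p.1 - v) (q.1 + v).
  by rewrite addrACA addNr addr0; lra.
have supS : has_sup S by split => //; eexists; exact: (Sub _ Gp0).
pose c := sup S; exists c.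
have c1 p : G p -> p.2 - c <= `|p.1 - v|.
  move=> Gp; have : p.2 - `|p.1 - v| <= c by apply: ub_le_sup; [case: supS|exists p].
  lra.
have c2 p : G p -> p.2 + c <= `|p.1 + v|.
  move=> Gp; have : c <= `|p.1 + v| - p.2 by apply: ge_sup => //; exact: Sub.
  lra.
have G0 : G (0, 0).
  by have := Glin (-1) _ _ Gp0 Gp0; rewrite scaleN1r mulN1r !addNr.
have Gscale a p : G p -> G (a *: p.1, a * p.2).
  by move=> Gp; have := Glin a _ _ Gp G0; rewrite /= !addr0.
split=> [a _ _ [p Gp [t ->]] [q Gq [t' ->]]|_ [p Gp [t ->]]] /=.
  exists (a *: p.1 + q.1, a * p.2 + q.2); first exact: Glin.
  exists (a * t + t') => /=; congr pair; last by ring.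
  by rewrite scalerDr scalerDl scalerA addrACA.
have [t0|t0|->] := ltgtP t 0; last by rewrite scale0r mul0r !addr0; exact: Gdom.
- have /c1 /= := Gscale (- t)^-1 _ Gp.
  have t0' : 0 < - t by rewrite oppr_gt0.
  rewrite -(ler_pM2l t0') -[X in _ <= X * _ -> _](gtr0_norm t0') -normrZ.
  rewrite mulrBr scalerBr mulVKf ?gt_eqF// scalerA divff ?gt_eqF// scale1r.
  by rewrite scaleNr mulNr !opprK.
- have /c2 /= := Gscale t^-1 _ Gp.
  rewrite -(ler_pM2l t0) -[X in _ <= X * _ -> _](gtr0_norm t0) -normrZ.
  by rewrite mulrDr scalerDr mulVKf ?gt_eqF// scalerA divff ?gt_eqF// scale1r.
Qed.

(** Hahn-Banach: a maximal dominated graph through [(e, |e|)] is defined everywhere, as otherwise it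
    could be extended; domination at [x] and [- x] bounds it. *)
Lemma norming_functional (e : X) : exists f : {linear X -> R^o},
  (forall x, `|f x| <= `|x|) /\ f e = `|e|.
Proof.
(* The second clause is guarded by nonemptiness because the empty chain has empty union. *)
pose P (G : set (X * R)) := dominated_graph G /\ (G !=set0 -> G (e, `|e|)).
have [F FP Ftot|A [[Adom Ae] Amax]] := @Zorn_bigcup _ P.
  split; last by case=> p [G FG Gp]; exists G => //; apply: (FP _ FG).2; exists p.
  split=> [a p q [G FG Gp] [H FH Hq]|p [G FG Gp]].
    have [GH|HG] := Ftot _ _ FG FH.
      by exists H => //; apply: (FP _ FH).1.1 => //; exact: GH.
    by exists G => //; apply: (FP _ FG).1.1 => //; exact: HG.
  exact: (FP _ FG).1.2.
have A0 : A !=set0.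
  apply/set0P/eqP => A0.
  pose L : set (X * R) := range (fun t => (t *: e, t * `|e|)).
  have Le : L (e, `|e|) by exists 1 => //; rewrite scale1r mul1r.
  apply: (Amax L); first by rewrite A0; split => // /(_ _ Le).
  split=> //; split=> [a _ _ [t _ <-] [t' _ <-]|_ [t _ <-]] /=.
    by exists (a * t + t') => //; rewrite scalerDl scalerA mulrDl mulrA.
  by rewrite normrZ ler_wpM2r// ler_norm.
have {}Ae := Ae A0.
have [Alin Adm] := Adom.
have A00 : A (0, 0).
  by have := Alin (-1) _ _ Ae Ae; rewrite scaleN1r mulN1r !addNr.
have total v : exists r, A (v, r).
  have [c Ac] := dominated_graph_extend v Adom A0; exists c.
  set B := [set q | _] in Ac.
  have AB : A `<=` B.
    move=> p Ap; exists p => //; exists 0.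
    by rewrite scale0r mul0r !addr0 -surjective_pairing.
  have Bv : B (v, c).
    by exists (0, 0) => //; exists 1; rewrite scale1r mul1r !add0r.
  apply: contrapT => nA; apply: (Amax B).
    by split => // /(_ _ Bv).
  by split=> // _; exact: AB.
have [g gA] := choice total.
have uniqA v r s : A (v, r) -> A (v, s) -> r = s.
  have h r' s' : A (v, r') -> A (v, s') -> s' <= r'.
    move=> Ar As; have := Adm _ (Alin (-1) _ _ Ar As).
    by rewrite /= scaleN1r mulN1r addNr normr0; lra.
  by move=> Ar As; apply/eqP; rewrite eq_le !h.
have lg : linear (g : X -> R^o).
  by move=> a u v; apply: uniqA (gA _) _; exact: (Alin a _ _ (gA u) (gA v)).
pose m := GRing.isLinear.Build R X R^o *:%R g lg.
pose f : {linear X -> R^o} := HB.pack (g : X -> R^o) m.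
exists f; split; last exact: uniqA (gA e) Ae.
move=> x; rewrite ler_norml (Adm _ (gA x)) andbT lerNl.
have := Adm _ (Alin (-1) _ _ (gA x) A00).
by rewrite /= !addr0 scaleN1r mulN1r normrN.
Qed.

End norming_functional.

(* Gliding hump: if [`|e n| > 2 * 3 ^ n * n], signs can be chosen inductively in
   [F = \sum_n (+/-) 3 ^- n *: phi n], with [phi n] norming [e n], so that the
   tail after the n-th term cannot undo its contribution at [e n]. *)
Lemma weakly_bounded_bounded (R : realType) (X : normedModType R) (E : set X) :
  (forall f : {linear X -> R^o}, continuous f ->
     exists M, forall e, E e -> `|f e| <= M) ->
  exists M, forall e, E e -> `|e| <= M.
Proof.
move=> Ew; apply: contrapT => /forallNP Eunb.
have /choice[e eP] : forall n : nat, exists e, E e /\ 2 * 3 ^+ n * n%:R < `|e|.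
  move=> n; apply: contrapT => /forallNP noe; apply: (Eunb (2 * 3 ^+ n * n%:R)).
  by move=> e Ee; rewrite leNgt; apply/negP => ?; apply: (noe e).
have [phi phiP] := choice (fun n => norming_functional (e n)).
pose d n : R := 3^-1 ^+ n.
have d0 n : 0 < d n by rewrite exprn_gt0// invr_gt0.
have dS n : d n.+1 = d n / 3 by rewrite /d exprSr.
pose F := fix F n : X -> R := if n is m.+1 then
    (if d m * `|e m| <= `|F m (e m) + d m * phi m (e m)|
     then fun x => F m x + d m * phi m x else fun x => F m x - d m * phi m x)
  else fun=> 0.
have Fstep n x : `|F n.+1 x - F n x| <= d n * `|x|.
  have h : `|d n * phi n x| <= d n * `|x|.
    by rewrite normrM gtr0_norm// ler_wpM2l ?(ltW (d0 n))// (phiP n).1.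
  by rewrite /=; case: ifP => _; rewrite addrAC subrr add0r// normrN.
(* For [b >= 0], one of [a + b] and [a - b] has modulus at least [b]. *)
have Fhump n : d n * `|e n| <= `|F n.+1 (e n)|.
  rewrite /=; case: ifPn => //; rewrite (phiP n).2 -ltNge => h.
  have dn : 0 <= d n * `|e n| by rewrite mulr_ge0 ?(ltW (d0 n)).
  have := ler_norm (F n (e n) + d n * `|e n|).
  have := ler_norm (- (F n (e n) - d n * `|e n|)).
  rewrite normrN; lra.
(* The geometric tail from [n] on sums to [3 / 2 * d n]; subtracting its remainder makes the
   induction exact. *)
have Ftail n k x : `|F (n + k)%N x - F n x| <= 3 / 2 * (d n - d (n + k)%N) * `|x|.
  elim: k => [|k IH]; first by rewrite addn0 !subrr normr0 mulr0 mul0r.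
  rewrite addnS; apply: (le_trans (ler_distD (F (n + k)%N x) _ _)).
  have := Fstep (n + k)%N x; rewrite dS; have := normr_ge0 x; lra.
have Fcauchy x : cvg (F n x @[n --> \oo]).
  apply/cauchy_cvgP/(@cauchy_seqP R R^o) => eps eps0.
  have /cvgrPdist_lt/(_ _ eps0)[N _ dN] : 3 * `|x| * d n @[n --> \oo] --> 0.
    rewrite -[X in _ --> X](mulr0 (3 * `|x|)); apply: cvgMl_tmp; apply: cvg_expr.
    by rewrite ger0_norm; lra.
  have close k : `|F (N + k)%N x - F N x| < eps / 2.
    have := dN N (leqnn N); rewrite sub0r normrN ger0_norm; last first.
      by rewrite !mulr_ge0// ltW.
    have := Ftail N k x; have := mulr_ge0 (ltW (d0 (N + k)%N)) (normr_ge0 x).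
    lra.
  exists N => m n Nm Nn; rewrite -(subnKC Nm) -(subnKC Nn).
  rewrite (le_lt_trans (ler_distD (F N x) _ _))// [ltRHS](splitr eps) ltrD//.
  by rewrite distrC.
pose f x : R := lim (F n x @[n --> \oo]).
have Flin n a u v : F n (a *: u + v) = a * F n u + F n v.
  elim: n => [|n IH] /=; first by rewrite mulr0 addr0.
  have phiP' : phi n (a *: u + v) = a * phi n u + phi n v by rewrite linearP.
  by case: ifP => _; rewrite IH phiP'; ring.
have lf : linear (f : X -> R^o).
  move=> a u v; apply: cvg_lim => //.
  rewrite (_ : (fun n => _) = fun n => a * F n u + F n v); last exact/funext.
  by apply: cvgD; [apply: cvgMl_tmp|]; exact: Fcauchy.
have fF n x : `|f x - F n x| <= 3 / 2 * d n * `|x|.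
  have c : `|F (n + k)%N x - F n x| @[k --> \oo] --> `|f x - F n x|.
    apply: cvg_norm; apply: cvgB; last exact: cvg_cst.
    rewrite (_ : (fun k => _) = fun k => F (k + n)%N x).
      by rewrite (cvg_shiftn n (fun k => F k x : R^o)); exact: Fcauchy.
    by apply/funext => k; rewrite addnC.
  apply: cvgr_to_le c _; apply: nearW => k; apply: (le_trans (Ftail n k x)).
  by rewrite ler_wpM2r// ler_wpM2l ?divr_ge0// gerBl ltW.
pose m := GRing.isLinear.Build R X R^o *:%R f lf.
pose g : {linear X -> R^o} := HB.pack (f : X -> R^o) m.
have cg : continuous g.
  apply: bounded_linear_continuous; apply/linear_boundedP.
  exists (3 / 2); split => [|r /ltW r32 x]; first exact: num_real.
  have := fF 0%N x; rewrite /= subr0 /d expr0 mulr1 => /le_trans; apply.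
  by rewrite ler_wpM2r.
have [M gM] := Ew g cg.
pose n := Num.truncn `|M|.
have := gM _ (eP n.+1).1; rewrite leNgt => /negP; apply.
have Mn : M < n.+1%:R.
  by rewrite (le_lt_trans (ler_norm M))// truncnS_gt.
apply: (lt_trans Mn).
(* The tail undoes at most half of the hump at [e n.+1], as [3 / 2 * d n.+2] is [d n.+1 / 2]; the
   factor 2 in the choice of [e] leaves more than [n.+1], hence more than [M]. *)
have := fF n.+2 (e n.+1); have := Fhump n.+1.
have := ler_normB (f (e n.+1)) (f (e n.+1) - F n.+2 (e n.+1)).
rewrite subKr [d n.+2]dS => h1 h2 h3.
have h4 : 2 * n.+1%:R < d n.+1 * `|e n.+1|.
  rewrite /d exprVn -ltr_pdivrMl ?invr_gt0 ?exprn_gt0// invrK.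
  by have := (eP n.+1).2; rewrite mulrAC; lra.
rewrite -[ltRHS]/(`|f (e n.+1)|); lra.
Qed.

(** * Weakly unconditionally Cauchy series and bounded multipliers *)

Section series_multipliers.
Variables (R : realType) (X : normedModType R) (x : nat -> X).

Lemma weakly_uncond_cauchy_abs_bounded : weakly_uncond_cauchy x ->
  forall f : {linear X -> R^o}, continuous f ->
    exists M, forall n, \sum_(0 <= i < n) `|f (x i)| <= M.
Proof.
move=> wx f fc; apply: (@unconditional_cauchy_absolutely_bounded R (f \o x)).
move=> p bp; have := wx p bp f fc.
rewrite (_ : f \o series (x \o p) = series ((f \o x) \o p))//.
by apply/funext => n; rewrite /= raddf_sum.
Qed.

(** For multipliers of modulus at most 1, the sums of [|f (x i)|] bound [f] on all partial sums.
    These are thus weakly bounded, hence bounded in norm, and scaling gives general [C]. *)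
Lemma weakly_uncond_cauchy_multiplier_bound : weakly_uncond_cauchy x ->
  exists2 H : R, 0 <= H & forall (a : nat -> R) C n, (forall i, `|a i| <= C) ->
    `|series (fun i => a i *: x i) n| <= H * C.
Proof.
move=> wx.
pose E : set X := [set e | exists (a : nat -> R) n, (forall i, `|a i| <= 1) /\
  e = series (fun i => a i *: x i) n].
have [H EH] : exists M, forall e, E e -> `|e| <= M.
  apply: weakly_bounded_bounded => f fc.
  have [M fM] := weakly_uncond_cauchy_abs_bounded wx fc.
  exists M => _ [a [n [a1 ->]]]; apply: le_trans (fM n).
  rewrite raddf_sum (le_trans (ler_norm_sum _ _ _))// ler_sum// => i _.
  by rewrite /= linearZ/= normrM ler_piMl.
exists `|H| => // a C n aC.
have C0 : 0 <= C by exact: le_trans (aC 0%N).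
have -> : series (fun i => a i *: x i) n =
    C *: series (fun i => (a i / C) *: x i) n.
  rewrite /series/= scaler_sumr; apply: eq_bigr => i _; rewrite scalerA.
  (* When [C = 0] the quotient [a i / C] is 0 by convention, and [a i] is 0 as well. *)
  have [Cz|Cn0] := eqVneq C 0; last by rewrite mulrC divfK.
  by have := aC i; rewrite Cz mul0r normr_le0 => /eqP ->.
rewrite normrZ (ger0_norm C0) mulrC ler_wpM2r//.
apply: le_trans (ler_norm H); apply: EH; exists (fun i => a i / C), n; split => //.
move=> i; rewrite normrM normfV (ger0_norm C0).
have [->|Cn0] := eqVneq C 0; first by rewrite invr0 mulr0.
by rewrite ler_pdivrMr ?mul1r// lt_def Cn0.
Qed.

(** A rearranged initial segment uses distinct indices, all below some [N], so its absolute sums are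
    still at most [M]; boundedness of [f] then gives absolute convergence of the images. *)
Lemma abs_bounded_weakly_uncond_cauchy M :
  (forall n, \sum_(0 <= i < n) `|x i| <= M) -> weakly_uncond_cauchy x.
Proof.
move=> xM p bp f fc.
have [C fC] : exists C, forall u, `|f u| <= C * `|u|.
  have /linear_boundedP := (linear_bounded_continuous f).2 fc.
  by move=> /pinfty_ex_gt0[C _ fC]; exists C.
have -> : f \o series (x \o p) = series (fun i => f (x (p i))).
  by apply/funext => n; rewrite /= raddf_sum.
apply: cvg_cauchy; apply: (@normed_cvg R R^o).
apply: nondecreasing_is_cvgn.
  by apply: (@nondecreasing_series _ _ xpredT 0) => i _ _; exact: normr_ge0.
exists (`|C| * M) => _ [n _ <-] /=.
apply: (@le_trans _ _ (`|C| * \sum_(0 <= i < n) `|x (p i)|)).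
  rewrite mulr_sumr ler_sum// => i _; apply: (le_trans (fC _)).
  by rewrite ler_wpM2r// ler_norm.
rewrite ler_wpM2l//; apply: le_trans (xM (\max_(i < n) p i).+1).
rewrite -(big_map p xpredT (fun j => `|x j|)).
set s := map p _; set N := (\max_(i < n) p i).+1.
have us : uniq s by rewrite map_inj_uniq ?iota_uniq//; exact: bij_inj.
have sN : {subset s <= index_iota 0 N}.
  move=> _ /mapP[i + ->]; rewrite !mem_index_iota /= => ni.
  by rewrite ltnS (@leq_bigmax _ (fun i : 'I_n => p i) (Ordinal ni)).
have ps : perm_eq s [seq j <- index_iota 0 N | j \in s].
  apply: uniq_perm => //; first by rewrite filter_uniq// iota_uniq.
  by move=> j; rewrite mem_filter andb_idr//; exact: sN.
rewrite (perm_big _ ps) big_filter big_mkcond ler_sum// => j _.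
by case: ifP.
Qed.

End series_multipliers.

(** * The sup norm on bounded sequences *)

Section sup_norm_theory.
Variable R : realType.
Implicit Types a b : nat -> R.

Lemma ell_inftyP a : ell_infty a <-> exists M, forall i, `|a i| <= M.
Proof.
have gP : ProperFilter (globally [set: nat]).
  exact: (globally_properfilter (a := 0%N)).
split=> [|[M aM]]; first by move=> /ex_bound[M aM]; exists M => i; exact: aM.
by apply/ex_bound; exists M => i _; exact: aM.
Qed.

Lemma le_sup_norm a i : ell_infty a -> `|a i| <= sup_norm a.
Proof.
move=> /ell_inftyP[M aM]; apply: ub_le_sup; last by exists i.
by exists M => _ [j _ <-].
Qed.

Lemma sup_norm_le a M : (forall i, `|a i| <= M) -> sup_norm a <= M.
Proof.
move=> aM; apply: ge_sup; first by exists `|a 0%N|, 0%N.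
by move=> _ [j _ <-].
Qed.

Lemma sup_norm_ge0 a : 0 <= sup_norm a.
Proof.
have [aB|aB] := pselect (has_sup [set `|a i| | i in [set: nat]]).
  apply: (@le_trans _ _ `|a 0%N|) => //; apply: ub_le_sup; first by case: aB.
  by exists 0%N.
(* A set without supremum gets the default value 0. *)
by rewrite /sup_norm sup_out.
Qed.

Lemma ell_inftyB a b : ell_infty a -> ell_infty b ->
  ell_infty (fun i => a i - b i).
Proof.
move=> /ell_inftyP[M aM] /ell_inftyP[N bN]; apply/ell_inftyP.
by exists (M + N) => i; rewrite (le_trans (ler_normB _ _))// lerD.
Qed.

Lemma ell_infty_complete : sup_norm_complete (@ell_infty R).
Proof.
move=> u uB uC.
have ptC e : 0 < e -> exists N, forall m n i, (N <= m)%N -> (N <= n)%N ->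
    `|u m i - u n i| < e.
  move=> e0; have [N uN] := uC e e0; exists N => m n i Nm Nn.
  apply: le_lt_trans (uN m n Nm Nn).
  exact: (@le_sup_norm (fun i => u m i - u n i) i (ell_inftyB (uB m) (uB n))).
have cu i : cvg (u n i @[n --> \oo]).
  apply/cauchy_cvgP/(@cauchy_seqP R R^o) => e e0.
  by have [N uN] := ptC e e0; exists N => m n; exact: uN.
pose a i := lim (u n i @[n --> \oo]).
have close e : 0 < e -> exists N, forall n i, (N <= n)%N -> `|u n i - a i| <= e.
  move=> e0; have [N uN] := ptC e e0; exists N => n i Nn.
  have c : `|u n i - u m i| @[m --> \oo] --> `|u n i - a i|.
    by apply: cvg_norm; apply: cvgB; [exact: cvg_cst|exact: cu].
  apply: cvgr_to_le c _; exists N => // m Nm; exact/ltW/uN.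
exists a.
  have [N aN] := close 1 ltr01; have /ell_inftyP[M uM] := uB N.
  apply/ell_inftyP; exists (M + 1) => i.
  rewrite -[a i](subKr (u N i)) (le_trans (ler_normB _ _))// lerD//; exact: aN.
apply/cvgrPdist_le => e e0; have [N aN] := close e e0.
exists N => // n Nn; rewrite sub0r normrN ger0_norm ?sup_norm_ge0//.
by apply: sup_norm_le => i; exact: aN.
Qed.

End sup_norm_theory.

(** * Lacunary statistical limits *)

Section lacunary_statistical_convergence.
Variables (R : realType) (k : nat -> nat).
Hypothesis hk : lacunary k.

Lemma lacunary_ge r : (r <= k r)%N.
Proof.
have [_ kmono _] := hk.
by elim: r => // r IH; exact: leq_ltn_trans IH (kmono _ _ (ltnSn r)).
Qed.

(** The exceptional set of [t] at level [e] lies in that of [s'] at level [d], so its block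
    densities are squeezed to 0. Letting [s'] depend on [e] suits uniform approximation. *)
Lemma S_theta_cvg_mono (X : normedModType R) (t : nat -> X) M :
  (forall e : R, 0 < e -> exists2 d : R, 0 < d &
     exists s' : nat -> X, exists L', S_theta_cvg k s' L' /\
       forall j, e <= `|t j - M| -> d <= `|s' j - L'|) ->
  S_theta_cvg k t M.
Proof.
move=> h e e0; have [d d0 [s' [L' [s'L' sub]]]] := h e e0.
apply: (@squeeze_cvgr _ _ _ _ (fun=> 0)); last exact: s'L' d d0.
  apply: nearW => r; rewrite mulr_ge0//= ler_wpM2l// ler_nat.
  exact: sub_count.
exact: cvg_cst.
Qed.

(** Block [r] lies beyond [r.-1], so for large [r] it has no exceptional index at all. *)
Lemma cvg_S_theta_cvg (X : normedModType R) (s : nat -> X) L :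
  s @ \oo --> L -> S_theta_cvg k s L.
Proof.
move=> /cvgrPdist_lt sL e e0; have [N _ sN] := sL e e0.
apply: cvg_near_cst; exists N.+1 => // r Nr /=.
rewrite (_ : count _ _ = 0%N) ?mulr0//; apply/eqP; rewrite -leqn0 leqNgt -has_count.
apply/hasPn => j; rewrite mem_index_iota => /andP[kj _]; rewrite -ltNge distrC.
apply: sN; rewrite /= (leq_trans _ (ltnW kj))// (leq_trans _ (lacunary_ge _))//.
by rewrite -ltnS (ltn_predK Nr).
Qed.

(** In a far block each exceptional set fills less than half, so the two cannot cover it. *)
Lemma S_theta_cvg2_near (X : normedModType R) (s t : nat -> X) L M (e : R) N :
  S_theta_cvg k s L -> S_theta_cvg k t M -> 0 < e ->
  exists j, [/\ (N <= j)%N, `|s j - L| < e & `|t j - M| < e].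
Proof.
move=> sL tM e0; have half0 : 0 < 2^-1 :> R by rewrite invr_gt0.
have /cvgrPdist_lt/(_ _ half0)[N1 _ sN] := sL e e0.
have /cvgrPdist_lt/(_ _ half0)[N2 _ tN] := tM e e0.
(* Being a successor, [r] has a nonempty block, which lies beyond [k r.-1 >= r.-1 >= N]. *)
pose r := (maxn N (maxn N1 N2)).+1.
have rN1 : (N1 <= r)%N by rewrite /r; lia.
have rN2 : (N2 <= r)%N by rewrite /r; lia.
have rN : (N <= k r.-1)%N by rewrite (leq_trans _ (lacunary_ge _))// /r /=; lia.
have gap0 : (0 < lacunary_gap k r)%N by have [_ + _] := hk; rewrite subn_gt0; apply.
have := tN r rN2; have := sN r rN1; rewrite /= !sub0r !normrN.
set P := fun j => e <= `|s j - L|; set Q := fun j => e <= `|t j - M|.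
rewrite !ger0_norm ?mulr_ge0// ![_^-1 * _]mulrC !ltr_pdivrMr ?ltr0n// => Plt Qlt.
have {Plt Qlt} PQ : (count P (lacunary_block k r) + count Q (lacunary_block k r)
    < size (lacunary_block k r))%N.
  rewrite size_iota subSS -(ltr_nat R) natrD.
  rewrite [ltRHS](_ : _ =
      2^-1 * (lacunary_gap k r)%:R + 2^-1 * (lacunary_gap k r)%:R).
    exact: ltrD.
  by rewrite /lacunary_gap; field.
have /hasP[j jB /norP[Pj Qj]] :
    has (predC (predU P Q)) (lacunary_block k r).
  rewrite has_predC all_count neq_ltn (leq_ltn_trans _ PQ)//.
  by rewrite -count_predUI leq_addr.
exists j; split; [|by rewrite ltNge|by rewrite ltNge].
by move: jB; rewrite mem_index_iota => /andP[kj _]; lia.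
Qed.

End lacunary_statistical_convergence.

(** * The two implications *)

Lemma series_scaleB (R : realType) (X : normedModType R) (a b : nat -> R)
    (x : nat -> X) n :
  series (fun i => a i *: x i) n - series (fun i => b i *: x i) n =
  series (fun i => (a i - b i) *: x i) n.
Proof.
by rewrite /series/= -sumrB; apply: eq_bigr => i _; rewrite scalerBl.
Qed.

Lemma S_theta_space_complete (R : realType) (X : normedModType R)
    (k : nat -> nat) (x : nat -> X) :
  lacunary k -> complete_space X -> weakly_uncond_cauchy x ->
  sup_norm_complete (S_theta_space k x).
Proof.
move=> hk Xc wx u uS uC.
have uB n : ell_infty (u n) by have [] := uS n.
have [a aB ua] := ell_infty_complete uB uC.
have [L LP] := choice (fun n => (uS n).2).
have [H H0 xH] := weakly_uncond_cauchy_multiplier_bound wx.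
have seriesH b c j : ell_infty b -> ell_infty c ->
    `|series (fun i => b i *: x i) j - series (fun i => c i *: x i) j| <=
    H * sup_norm (fun i => b i - c i).
  move=> bB cB; rewrite series_scaleB; apply: xH => i.
  exact: (@le_sup_norm _ (fun i => b i - c i) i (ell_inftyB bB cB)).
(* An index good for both [L m] and [L n] transfers the uniform bound on partial sums to the limits,
   up to any [e]. *)
have LH m n : `|L m - L n| <= H * sup_norm (fun i => u m i - u n i).
  apply/ler_addgt0Pr => e e0.
  have [j [_ Lm Ln]] := S_theta_cvg2_near hk 0 (LP m) (LP n) (divr_gt0 e0 (ltr0n R 2)).
  have := seriesH _ _ j (uB m) (uB n).
  move: Lm Ln; set s := series _ j; set t := series _ j => Lm Ln st.
  have -> : L m - L n = (s - t) - (s - L m) + (t - L n).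
    by rewrite opprB [s - t + _]addrC !subrKA.
  rewrite (le_trans (ler_normD _ _))// [e in leRHS]splitr addrA lerD ?(ltW Ln)//.
  by rewrite (le_trans (ler_normB _ _))// lerD// ltW.
have H1 : 0 < H + 1 by rewrite ltr_wpDl.
have small (e : R) : 0 < e -> exists2 d, 0 < d & forall t, t < d -> H * t < e.
  (* Dividing by [H + 1] covers [H = 0]. *)
  move=> e0; exists (e / (H + 1)); first by rewrite divr_gt0.
  move=> t; rewrite ltr_pdivlMr// => te.
  have [t0|t0] := ltP t 0; first by rewrite (le_lt_trans _ e0)// mulr_ge0_le0// ltW.
  lra.
have /cvg_ex[l Ll] : cvg (L @ \oo).
  apply: Xc; apply/cauchy_seqP => e /small[d d0 Hd]; have [N uN] := uC d d0.
  by exists N => m n Nm Nn; apply: le_lt_trans (LH m n) _; exact/Hd/uN.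
exists a => //; split=> //; exists l.
apply: S_theta_cvg_mono => e e0.
have e3 : 0 < e / 3 by rewrite divr_gt0.
exists (e / 3) => //; have [d d0 Hd] := small _ e3.
have [N1 _ uN1] := (cvgrPdist_lt _ _).1 ua d d0.
have [N2 _ LN2] := (cvgrPdist_lt _ _).1 Ll _ e3.
(* This [n] brings both [|s - t|] and [|l - L n|] below [e / 3], so [|t - l| >= e] forces
   [|s - L n| >= e / 3]. *)
pose n := maxn N1 N2.
have ud : sup_norm (fun i => u n i - a i) < d.
  have := uN1 n (leq_maxl _ _); rewrite /= sub0r normrN; apply: le_lt_trans.
  exact: ler_norm.
have Ld : `|l - L n| < e / 3 := LN2 n (leq_maxr _ _).
exists (series (fun i => u n i *: x i)), (L n); split; first exact: LP.
move=> j; have := seriesH _ _ j (uB n) aB; have := Hd _ ud.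
set s := series _ j; set t := series _ j => He st ej.
have : `|t - l| <= `|s - L n| + `|s - t| + `|l - L n|.
  have -> : t - l = (s - L n) - (s - t) - (l - L n).
    by rewrite !opprB [s - L n + _]addrC !subrKA.
  by rewrite (le_trans (ler_normB _ _))// lerD2r ler_normB.
lra.
Qed.

Lemma complete_of_S_theta_space_complete (R : realType) (X : normedModType R)
    (k : nat -> nat) :
  lacunary k ->
  (forall x : nat -> X, weakly_uncond_cauchy x ->
     sup_norm_complete (S_theta_space k x)) ->
  complete_space X.
Proof.
move=> hk Sc F PF Fc.
pose d n : R := 2^-1 ^+ n.
have d0 n : 0 < d n by rewrite exprn_gt0// invr_gt0.
have dS n : d n.+1 = d n / 2 by rewrite /d exprSr.
have dle m n : (m <= n)%N -> d n <= d m.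
  by move=> mn; rewrite /d ler_wiXn2l//; lra.
have dsmall e : 0 < e -> exists N, d N < e.
  move=> e0; have /cvgrPdist_lt/(_ _ e0)[N _ dN] : d n @[n --> \oo] --> 0.
    by apply: cvg_expr; rewrite ger0_norm; lra.
  by exists N; have := dN N (leqnn N); rewrite sub0r normrN ger0_norm// ltW.
(* The tolerance 4^-n has a factor [d n] to spare: after division by [d i] the terms [x i] still
   have norm at most [2 * d i]. *)
have /choice[y yP] n : exists y, F (ball y (d n * d n)).
  by have /cauchyP := Fc; apply; rewrite mulr_gt0.
have yS n : `|y n.+1 - y n| <= 2 * (d n * d n).
  have [z [/=]] := filter_ex (filterI (yP n) (yP n.+1)).
  rewrite -ball_normE /= => yz yz'.
  apply: (le_trans (ler_distD z _ _)); rewrite [`|z - y n|]distrC.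
  have := ltW yz; have := ltW yz'; rewrite dS.
  have := mulr_gt0 (d0 n) (d0 n); lra.
pose x i := (d i)^-1 *: (y i.+1 - y i).
have xd i : `|x i| <= 2 * d i.
  rewrite normrZ normfV (gtr0_norm (d0 i)) ler_pdivrMl//.
  by rewrite (le_trans (yS i))// mulrCA.
have wx : weakly_uncond_cauchy x.
  apply: (@abs_bounded_weakly_uncond_cauchy _ _ _ 4) => n.
  (* The strengthened bound is the exact partial sum of the geometric series of [2 * d i]. *)
  suff h : \sum_(0 <= i < n) `|x i| <= 4 * (1 - d n) by have := d0 n; lra.
  elim: n => [|n IH]; first by rewrite big_geq// /d expr0 subrr mulr0.
  by rewrite big_nat_recr//= dS; have := xd n; lra.
pose u n i := if (i < n)%N then d i else 0.
have uS n : S_theta_space k x (u n).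
  split.
    apply/ell_inftyP; exists 1 => i; rewrite /u; case: ifP => _; last first.
      by rewrite normr0.
    by rewrite ger0_norm ?(ltW (d0 i))// -[1]/(d 0%N) dle.
  exists (series (fun i => u n i *: x i) n); apply: cvg_S_theta_cvg => //.
  apply: cvg_near_cst; exists n => // m nm; rewrite /series/=.
  rewrite (big_cat_nat (n := n))//= -[RHS]addr0; congr (_ + _).
  by rewrite big_nat big1// => i /andP[ni _]; rewrite /u ltnNge ni/= scale0r.
have uu m n : (m <= n)%N -> forall i, `|u m i - u n i| <= d m.
  move=> mn i; rewrite /u; case: ifP => im.
    by rewrite (leq_trans im mn) subrr normr0 ltW.
  case: ifP => _; last by rewrite subrr normr0 ltW.
  by rewrite sub0r normrN ger0_norm ?(ltW (d0 i))// dle// leqNgt im.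
have uC e : 0 < e -> exists N, forall m n, (N <= m)%N -> (N <= n)%N ->
    sup_norm (fun i => u m i - u n i) < e.
  move=> /dsmall[N Ne]; exists N => m n Nm Nn; apply: le_lt_trans Ne.
  apply: sup_norm_le => i; have [mn|nm] := leqP m n.
    exact: le_trans (uu _ _ mn i) (dle _ _ Nm).
  by rewrite distrC; exact: le_trans (uu _ _ (ltnW nm) i) (dle _ _ Nn).
have [a [aB [L aL]] ua] := Sc x wx u uS uC.
(* Sup-norm convergence is coordinatewise, and [u n i] equals [d i] as soon as [i < n]. *)
have ad i : a i = d i.
  apply/eqP; rewrite -subr_eq0 -normr_le0; apply/ler_addgt0Pr => e e0.
  rewrite add0r.
  have [N _ uN] := (cvgrPdist_lt _ _).1 ua e e0.
  pose n := maxn N i.+1.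
  have := uN n (leq_maxl _ _); rewrite /= sub0r normrN => h.
  have -> : d i = u n i by rewrite /u leq_maxr.
  rewrite distrC; apply: (le_trans _ (ltW (le_lt_trans (ler_norm _) h))).
  exact: (@le_sup_norm _ (fun i => u n i - a i) i (ell_inftyB (uS n).1 aB)).
have sE n : series (fun i => a i *: x i) n = y n - y 0%N.
  rewrite -[RHS](telescope_sumr y)// /series/=; apply: eq_bigr => i _.
  by rewrite ad scalerA divff ?gt_eqF// scale1r.
apply/cvg_ex; exists (y 0%N + L).
apply/cvg_ballP => e e0.
have e2 : 0 < e / 2 by rewrite divr_gt0.
have [N dN] := dsmall _ e2.
(* The same sequence fills both slots: a single index [j >= N] with [y j - y 0] close to [L]
   suffices, since [F] contains a small ball about [y j]. *)
have [j [Nj yL _]] := S_theta_cvg2_near hk N aL aL e2.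
apply: filterS (yP j) => z; rewrite -!ball_normE /= => yz.
rewrite sE in yL.
have -> : y 0%N + L - z = (y j - z) - (y j - y 0%N - L).
  by rewrite !opprB addrCA [y j - z + _]addrC subrKA addrCA addrA.
rewrite (le_lt_trans (ler_normB _ _))// [ltRHS]splitr ltrD//.
apply: lt_trans yz _; apply: le_lt_trans dN; apply: le_trans (dle _ _ Nj).
by rewrite ler_piMr ?(ltW (d0 j))// -[1]/(d 0%N) dle.
Qed.

Theorem theorem5p2 (R : realType) (X : normedModType R) (k : nat -> nat)
    (hk : lacunary k) :
  complete_space X <->
  (forall x : nat -> X, weakly_uncond_cauchy x ->
     sup_norm_complete (S_theta_space k x)).
Proof.
split=> [Xc x|]; first exact: S_theta_space_complete.
exact: complete_of_S_theta_space_complete.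
Qed.
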